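(* Let $G$ be a finite group. Then $G$ is an ON-group if and only if $G$ is a Dedekind group or $G$ satisfies the following conditions: (1) $G=P_1\cdot P_2\cdots P_n\cdot P$, where $P_1,P_2,\dots,P_n$ are normal abelian Sylow $p_i$-subgroups of $G$ ($P_i$ being a Sylow $p_i$-subgroup), and $P=\langle x\rangle$ is a cyclic Sylow $p$-subgroup of $G$ with $\langle x^p\rangle=O_p(G)$. (2) $N_G(P)=P$. (3) Let $H_1:=P_1\cdot P_2\cdots P_n$. Then for every $1\neq w\in H_1$ one has $w^x=w^m$ for some integer $m$ with $(m,o(w))=(m-1,o(w))=1$.
   Context: For a subgroup $H$ of $G$, $H^G$ denotes the normal closure of $H$ in $G$. $G$ is an ON-group if for every subgroup $H$ of $G$, either $N_G(H)=H$ and $H^G=G$, or $H\unlhd G$. A Dedekind group is a group all of whose subgroups are normal. $w^x=x^{-1}wx$, $o(w)$ is the order of $w$, and $p_1,\dots,p_n,p$ are the distinct prime divisors of $|G|$. *)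

(* Defs.v *)
From mathcomp Require Import all_boot all_order all_algebra all_fingroup all_solvable.

Set Implicit Arguments.
Unset Strict Implicit.
Unset Printing Implicit Defensive.

Import GroupScope.

Definition normal_closure (gT : finGroupType) (H G : {set gT}) : {set gT} :=
  <<class_support H G>>.

(* The alternative is inclusive: H = G satisfies both sides. *)
Definition ON_group (gT : finGroupType) (G : {group gT}) : Prop :=
  forall H : {group gT}, H \subset G ->
    ('N_G(H) = H /\ normal_closure H G = G) \/ H <| G.

Definition Dedekind_group (gT : finGroupType) (G : {group gT}) : Prop :=
  forall H : {group gT}, H \subset G -> H <| G.

Definition expgz (gT : finGroupType) (w : gT) (m : int) : gT :=
  match m with
  | Posz k => w ^+ k
  | Negz k => w ^- k.+1
  end.

(* Main.v *)
Require Import Defs.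
From mathcomp Require Import all_boot all_order all_algebra all_fingroup all_solvable.

Import GroupScope.

(* In an ON-group G every proper subgroup of a nilpotent subgroup is normal in
   G, since it grows in its normaliser.  If G is not Dedekind, it is therefore
   not nilpotent and has a non-normal, hence self-normalising, Sylow p-subgroup
   P; an element of P outside 'O_p(G) must generate P.  The conjugates of the
   generators of a self-normalising nontrivial cyclic q-group fill at least half
   of G and miss 1, so p is the only prime with a non-normal Sylow subgroup, and
   the other Sylow subgroups generate a normal nilpotent p-complement K.  As
   'C_K[x] = 1, x maps every w in K to a power w ^+ k.+1 with k coprime to #[w].

   Conversely, a subgroup H either contains a conjugate of P, in which case the
   Frattini argument makes it self-normalising and the commutators [~ w, x] show
   that its normal closure contains K, or it is the product of K :&: H with a
   subgroup of the cyclic group 'O_p(G), both of which are normal in G. *)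

(** * Nilpotency and self-normalising cyclic subgroups *)

Lemma normal_Sylows_nilpotent {gT : finGroupType} {G : {group gT}} :
  (forall P : {group gT}, Sylow G P -> P <| G) -> nilpotent G.
Proof.
move=> nSG; apply: nilpotentS (Fitting_nil G).
rewrite -{1}(Sylow_gen G) gen_subG; apply/bigcupsP=> P sylP.
apply: Fitting_max (nSG P sylP) _.
by case/SylowP: sylP => p _ /pHall_pgroup/pgroup_nil.
Qed.

(* The generators of <[x]> form a TI-subset with normaliser <[x]>, and at least
   half of the elements of a nontrivial cyclic p-group are generators. *)
Lemma card_generator_support {gT : finGroupType} {G : {group gT}} {x : gT} {p} :
    prime p -> p.-elt x -> x != 1 -> 'N_G(<[x]>) = <[x]> ->
  #|G| <= 2 * #|class_support [set u | generator <[x]> u] G|.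
Proof.
move=> p_pr px ntx Nx; set A := [set u | _].
have sxG: <[x]> \subset G by rewrite -Nx subsetIl.
have tiA: normedTI A G <[x]>.
  apply/normedTI_P; split.
  - by apply/set0Pn; exists x; rewrite inE generator_cycle.
  - apply/subsetP=> y xy; rewrite inE (subsetP sxG) //= inE.
    apply/subsetP=> _ /imsetP[u Au ->].
    have xu: u \in <[x]> by move: Au; rewrite inE => /cycle_generator.
    by rewrite conjgE (centsP (cycle_abelian x) u xu y xy) mulKg.
  move=> g Gg; rewrite -setI_eq0 => /set0Pn[u /setIP[]].
  rewrite !inE => /eqP xu /imsetP[v]; rewrite inE => /eqP xv def_u.
  by rewrite /= -Nx inE Gg; apply/normP; rewrite {1}xv -cycleJ -def_u -xu.
rewrite (card_support_normedTI tiA) -totient_gen mulnA -(Lagrange sxG) leq_mul //.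
have [n ox] := p_natP px; rewrite -orderE ox.
case: n ox => [|n] ox; first by rewrite -order_eq1 ox in ntx.
(* What remains is [p <= 2 * p.-1], since [#[x]] and its totient are in the ratio of [p] to
   [p.-1]. *)
rewrite totient_pfactor // mulnA expnS leq_mul //=.
by case: p p_pr {px ox} => [|[|p]] //= _; rewrite mul2n -addnn addnS ltnS leq_addr.
Qed.

(** If [p != q], the two sets of conjugate generators are disjoint subsets of [G^#]. Each has at
    least half as many elements as [G], so together they outnumber [G^#]. *)
Lemma self_normalizing_cyclic_prime_uniq {gT : finGroupType} (G : {group gT})
    {x y : gT} {p q} :
    prime p -> prime q -> p.-elt x -> q.-elt y -> x != 1 -> y != 1 ->
    'N_G(<[x]>) = <[x]> -> 'N_G(<[y]>) = <[y]> ->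
  p = q.
Proof.
move=> p_pr q_pr px qy ntx nty Nx Ny; apply/eqP/negPn/negP=> neq_pq.
have leA := card_generator_support p_pr px ntx Nx.
have leB := card_generator_support q_pr qy nty Ny.
have gen_pelt r z u : r.-elt z -> z != 1 -> z \in G ->
    u \in class_support [set u | generator <[z]> u] G ->
  [/\ u \in G, u != 1 & r.-elt u].
  move=> rz ntz Gz /imset2P[v g]; rewrite inE => /eqP zv Gg ->.
  have Gv: v \in G by rewrite -cycle_subG -zv cycle_subG.
  rewrite groupJ // conjg_eq1 -cycle_eq1 -zv cycle_eq1; split=> //.
  by rewrite p_eltJ /p_elt orderE -zv.
set A := class_support _ G in leA gen_pelt; set B := class_support _ G in leB.
have Gx: x \in G by rewrite -cycle_subG -Nx subsetIl.
have Gy: y \in G by rewrite -cycle_subG -Ny subsetIl.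
have sABG: A :|: B \subset G^#.
  apply/subsetP=> u; rewrite !inE.
  by case/orP=> [/(gen_pelt p) | /(gen_pelt q)] [] // -> ->.
have /eqP tiAB: A :&: B == set0.
  apply/set0Pn=> -[u /setIP[/(gen_pelt p)[] // _ ntu pu /(gen_pelt q)[] // _ _ qu]].
  case/eqP: ntu; apply/eqP; rewrite -order_eq1; apply/eqP; apply: pnat_1 pu _.
  by apply: sub_in_pnat qu => r _ /eqnP->; rewrite !inE eq_sym.
have:= subset_leq_card sABG; rewrite cardsU tiAB cards0 subn0 -ltnS.
have <-: #|G| = #|G^#|.+1 by rewrite (cardsD1 1 G) group1.
rewrite ltnNge -(leq_pmul2l (isT : 0 < 2)) mulnDr; case/negP.
by rewrite mul2n -addnn leq_add.
Qed.

(** * Normal and Sylow subgroups of ON-groups *)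

Lemma ON_nilpotent_sub {gT : finGroupType} {G N H : {group gT}} :
  ON_group G -> N \subset G -> nilpotent N -> H \proper N -> H <| G.
Proof.
move=> onG sNG nilN prHN.
have [[NH _] |//] := onG H (subset_trans (proper_sub prHN) sNG).
have /properP[_ [y NNy H'y]] := nilpotent_proper_norm nilN prHN.
by case/negP: H'y; rewrite -NH (subsetP (setSI _ sNG)).
Qed.

Lemma ON_nonnormal_Sylow {gT : finGroupType} {G P : {group gT}} {p} :
    ON_group G -> p.-Sylow(G) P -> ~~ (P <| G) ->
  exists x, [/\ P :=: <[x]>, x != 1, 'N_G(P) = P & <[x ^+ p]> = 'O_p(G)].
Proof.
move=> onG sylP nnP; have [sPG pP _] := and3P sylP.
have NP: 'N_G(P) = P by case: (onG P sPG) nnP => [[] | ->].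
have propP := ON_nilpotent_sub onG sPG (pgroup_nil pP).
have prO: 'O_p(G) \proper P.
  rewrite properEneq pcore_sub_Hall // andbT; apply: contraNneq nnP => <-.
  exact: pcore_normal.
have /properP[_ [x Px O'x]] := prO.
have sxP: <[x]> \subset P by rewrite cycle_subG.
have defP: P :=: <[x]>.
  apply/eqP; rewrite eq_sym; apply: contraR O'x => neqP.
  rewrite -cycle_subG pcore_max ?(pgroupS sxP) //.
  by apply: propP; rewrite properEneq neqP.
have ntx: x != 1 by apply: contraNneq O'x => ->.
exists x; split=> //; have px := mem_p_elt pP Px.
have [[|n] ox] := p_natP px; first by rewrite -order_eq1 ox in ntx.
have p_pr: prime p.
  by have [] := pgroup_pdiv pP _; rewrite // defP cycle_eq1.
have oxp: #[x ^+ p] = (p ^ n)%N.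
  by rewrite orderXdiv ox expnS ?dvdn_mulr // mulKn ?prime_gt0.
(* As a proper subgroup of [P], [<[x ^+ p]>] is normal in [G] and lies in ['O_p(G)]. Its index in
   [P] is [p], so the proper subgroup ['O_p(G)] of [P] cannot be larger. *)
apply/eqP; rewrite eqEcard -orderE oxp; apply/andP; split.
  apply: pcore_max; first by rewrite (pgroupS _ pP) // cycle_subG groupX.
  apply: propP; rewrite properEcard defP cycleX -!orderE oxp ox.
  by rewrite (ltn_exp2l _ _ (prime_gt1 p_pr)) ltnSn.
have [m om] := p_natP (pcore_pgroup p G).
have := proper_card prO; rewrite om defP -orderE ox.
by rewrite (ltn_exp2l _ _ (prime_gt1 p_pr)) (leq_exp2l _ _ (prime_gt1 p_pr)).
Qed.

(** * Power maps without fixed points *)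

Lemma mem_cycle_commg {gT : finGroupType} {w x : gT} {k} :
  w ^ x = w ^+ k.+1 -> coprime k #[w] -> w \in <[[~ w, x]]>.
Proof.
(* Here [[~ w, x] = w ^+ k], a generator of [<[w]>]. *)
rewrite commgEl => -> cokw; rewrite expgS mulKg.
by move: cokw; rewrite coprime_sym -generator_coprime => /eqP <-; apply: cycle_id.
Qed.

(** If some [d > 1] divided both [k] and [#[w]], then [w ^+ (#[w] %/ d)] would be a nontrivial
    element fixed by [x]. *)
Lemma fixfree_power {gT : finGroupType} {w x : gT} :
    w ^ x \in <[w]> -> 'C_<[w]>[x] = 1 ->
  exists2 k, w ^ x = w ^+ k.+1 & coprime k #[w].
Proof.
have [-> | ntw] := eqVneq w 1.
  by exists 0; rewrite ?conj1g ?expg1n ?order1 ?coprimen1.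
case/cycleP=> [[|k]] wx fixx.
  by rewrite -(conjg_eq1 w x) wx expg0 eqxx in ntw.
exists k => //; apply: contraTT isT => neq1.
have [d [d_gt1 dk dw]]: exists d, [/\ 1 < d, d %| k & d %| #[w]].
  exists (gcdn k #[w]); rewrite dvdn_gcdl dvdn_gcdr; split=> //.
  by rewrite ltn_neqAle eq_sym neq1 gcdn_gt0 order_gt0 orbT.
have d_gt0 := ltnW d_gt1.
have wd_gt0: 0 < #[w] %/ d by rewrite (divn_gt0 _ d_gt0) (dvdn_leq (order_gt0 w) dw).
have: w ^+ (#[w] %/ d) \in 'C_<[w]>[x].
  rewrite inE mem_cycle; apply/cent1P/commgP/conjg_fixP.
  rewrite conjXg wx -expgM mulSn expgD -[RHS]mulg1; congr (_ * _).
  by apply/eqP; rewrite -order_dvdn -{1}(divnK dw) mulnC (dvdn_pmul2r wd_gt0).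
by rewrite fixx inE -order_dvdn (gtnNdvd wd_gt0 (ltn_Pdiv d_gt1 (order_gt0 w))).
Qed.

(** Replaces the integer exponent of condition (3) by a natural number [k.+1] congruent to [m]
    modulo [#[w]]. *)
Lemma expgz_coprime_pred {gT : finGroupType} (w : gT) (m : int) :
    coprimez m #[w]%:Z -> coprimez (m - 1)%R #[w]%:Z ->
  exists2 k, expgz w m = w ^+ k.+1 & coprime k #[w].
Proof.
case: m => [[|k]|k].
- rewrite /coprimez /gcdz /= gcd0n => /eqP[w1] _.
  by exists 0; rewrite ?w1 // (eqP (_ : w == 1)) ?expg1n // -order_eq1 w1.
- by move=> _; rewrite -{1}addn1 PoszD GRing.addrK => cokw; exists k.
rewrite /coprimez /gcdz NegzE -GRing.opprD -PoszD addn1 !abszN !absz_nat => _ cokw.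
(* Modulo [#[w]] this is [- k.+2], that is [m - 1], and both factors are coprime to [#[w]]. *)
exists (k.+2 * #[w].-1)%N.
  apply: (mulIg (w ^+ k.+1)); rewrite [LHS]mulVg -expgD addSnnS -mulnSr.
  by rewrite (prednK (order_gt0 w)) mulnC expgM expg_order expg1n.
rewrite coprimeMl -{3}(prednK (order_gt0 w)) coprimenS andbT.
exact: cokw.
Qed.

(** Each [<[w]>] with [w] in [K] is normal in [G], being [K] itself or a proper subgroup of the
    nilpotent [K]. Hence conjugation maps [w] to powers of [w], and [fixfree_power] applies to
    [x]. *)
Lemma ON_fixfree {gT : finGroupType} {G K : {group gT}} {x : gT} :
    ON_group G -> K <| G -> nilpotent K -> x \in G -> 'C_K[x] = 1 ->
  {in K, forall w, exists2 k, w ^ x = w ^+ k.+1 & coprime k #[w]} /\ abelian K.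
Proof.
move=> onG nKG nilK Gx fixx; have [sKG nKG'] := andP nKG.
have nsw w : w \in K -> G \subset 'N(<[w]>).
  move=> Kw; have [-> // | neqK] := eqVneq <[w]> K.
  apply/normal_norm/(ON_nilpotent_sub onG sKG nilK).
  by rewrite properEneq neqK cycle_subG.
have powJ w g : w \in K -> g \in G -> w ^ g \in <[w]>.
  by move=> Kw Gg; rewrite memJ_norm ?cycle_id // (subsetP (nsw w Kw)).
have powx : {in K, forall w, exists2 k, w ^ x = w ^+ k.+1 & coprime k #[w]}.
  move=> w Kw; apply: fixfree_power; first exact: powJ.
  by apply/trivgP; rewrite -fixx setSI ?cycle_subG.
split=> //; apply/centsP=> v Kv w Kw.
(* <[w]> is normal with abelian automorphism group, so commutators of G
   centralise it, and v is a power of [~ v, x]. *)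
have [k vx cok] := powx v Kv.
have: v \in <[[~ v, x]]> by apply: mem_cycle_commg vx cok.
suffices: <[[~ v, x]]> \subset 'C[w] by move=> sC /(subsetP sC)/cent1P.
have Gv := subsetP sKG v Kv; rewrite cycle_subG; apply/cent1P/esym/commgP/conjg_fixP.
have swap u : u \in K -> u ^ (v * x) = u ^ (x * v).
  move=> Ku; have /cycleP[a uv] := powJ u v Ku Gv.
  have /cycleP[b ux] := powJ u x Ku Gx.
  by rewrite !conjgM uv ux !conjXg uv ux -!expgM mulnC.
have ->: [~ v, x] = (x * v)^-1 * (v * x) by rewrite commgEl conjgE invMg !mulgA.
by rewrite conjgM swap ?conjgKV // memJ_norm // groupV (subsetP nKG') ?groupM.
Qed.

(** * Sufficiency of the conditions *)

Lemma power_action_ON {gT : finGroupType} {G K : {group gT}} {x : gT} {p} :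
    prime p -> p.-Sylow(G) <[x]> -> <[x ^+ p]> = 'O_p(G) ->
    'N_G(<[x]>) = <[x]> -> K <| G -> abelian K -> K * <[x]> = G ->
    p^'.-group K ->
    {in K, forall w, exists2 k, w ^ x = w ^+ k.+1 & coprime k #[w]} ->
  ON_group G.
Proof.
move=> p_pr sylP defO NP nKG abK defG p'K powx H sHG; have [sKG _] := andP nKG.
have [sPG pP _] := and3P sylP.
(* [L] is normalised by the abelian [K], and by [x], which maps elements of [K] to their powers. *)
have nsK (L : {group gT}) : L \subset K -> L <| G.
  move=> sLK; rewrite /normal (subset_trans sLK) //= -defG mulG_subG.
  rewrite sub_abelian_norm //= cycle_subG inE; apply/subsetP=> _ /imsetP[w Lw ->].
  by have [k -> _] := powx w (subsetP sLK w Lw); rewrite groupX.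
have [Q sylQ] := Sylow_exists p H; have [sQH pQ _] := and3P sylQ.
have sQG := subset_trans sQH sHG.
have [g Gg sQP] := Sylow_Jsub sylP sQG pQ.
(* The alternative depends on whether a Sylow [p]-subgroup of [H] is already one of [G]. *)
have [eqQP | neqQP] := eqVneq (Q :^ g) <[x]>; [left | right].
  have NQ: 'N_G(Q) = Q.
    by apply: (can_inj (conjsgK g)); rewrite conjIg -normJ (conjGid Gg) eqQP NP.
  split.
    apply/eqP; rewrite eqEsubset subsetI sHG normG !andbT.
    rewrite -{1}(Frattini_arg (normalSG sHG) sylQ) mulG_subG subxx /=.
    by rewrite (subset_trans _ sQH) // -{2}NQ setSI ?subsetIl.
  apply/eqP; rewrite eqEsubset gen_subG class_support_subG //=.
  pose N := <<class_support H G>>%G; rewrite -[normal_closure _ _]/(gval N).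
  have nNG: G \subset 'N(N) by rewrite norms_gen ?class_support_norm.
  have Nx: x \in N.
    rewrite -cycle_subG -eqQP -(normsP nNG g Gg) conjSg (subset_trans sQH) //.
    by rewrite (subset_trans _ (subset_gen _)) ?sub_class_support.
  rewrite -defG mulG_subG cycle_subG Nx andbT.
  apply/subsetP=> w Kw; have [k wx cok] := powx w Kw.
  suffices: <[[~ w, x]]> \subset N.
    by move/subsetP; apply; apply: mem_cycle_commg wx cok.
  rewrite cycle_subG commgEr groupM // memJ_norm ?groupV //.
  by rewrite (subsetP nNG) // (subsetP sKG).
have nsQ: Q <| G.
  (* A power [x ^+ j] with [p] not dividing [j] would generate [<[x]>]. *)
  have sQO: Q :^ g \subset <[x ^+ p]>.
    have /cyclicP[y def_y] : cyclic (Q :^ g) := cyclicS sQP (cycle_cyclic x).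
    rewrite def_y cycle_subG in sQP neqQP *; have /cycleP[j def_yj] := sQP.
    rewrite def_yj in neqQP *; have [/dvdnP[i ->] | p'j] := boolP (p %| j).
      by rewrite mulnC expgM cycleX.
    case/eqP: neqQP; apply/esym/eqP; rewrite -[_ == _]/(generator _ _).
    rewrite generator_coprime orderE; have [n ->] := p_natP pP.
    by rewrite coprimeXl // prime_coprime.
  have nsQg: Q :^ g <| G.
    have: Q :^ g \char 'O_p(G) by rewrite -defO sub_cyclic_char ?cycle_cyclic.
    by move/char_normal_trans; apply; apply: pcore_normal.
  by rewrite -(normalJ _ _ g) (conjGid Gg).
have hallK: p^'.-Hall(G) K.
  apply: (coprime_mulpG_Hall defG p'K _).1; rewrite (eq_pgroup _ (negnK p)).
  exact: pP.
have hallKH := setI_normal_Hall nKG hallK sHG.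
have <-: (K :&: H) * Q = H.
  apply/eqP; rewrite eqEcard mulG_subG subsetIr sQH coprime_cardMg.
    by rewrite (card_Hall hallKH) (card_Hall sylQ) mulnC partnC ?leqnn.
  by rewrite coprime_sym; apply: pnat_coprime pQ (pHall_pgroup hallKH).
by rewrite normalM // nsK // subsetIl.
Qed.

(** Turns the set product [H1] into a normal subgroup; its description by generators reduces upper
    bounds on [K] to the factors. *)
Lemma prodg_normal {gT : finGroupType} {I : finType} {G : {group gT}}
    {P_ : I -> {group gT}} :
    (forall i, P_ i <| G) ->
  exists K : {group gT},
    [/\ \prod_i (P_ i : {set gT}) = K, K :=: <<\bigcup_i P_ i>> & K <| G].
Proof.
move=> nP; have [K defK nKG]: exists2 K : {group gT},
    \prod_i (P_ i : {set gT}) = K & K <| G.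
  elim/big_ind: _ => [|_ _ [A -> nA] [B -> nB] | i _].
  - by exists 1%G; rewrite ?normal1.
  - exists (A <*> B)%G; last by rewrite normalY.
    by rewrite /= norm_joinEr // (subset_trans (normal_sub nB)) ?normal_norm.
  by exists (P_ i).
exists K; split=> //; apply/eqP; rewrite eqEsubset gen_subG; apply/andP; split.
  rewrite -defK; apply/subsetP=> _ /prodsgP[c Pc ->]; apply: group_prod => i _.
  by rewrite mem_gen //; apply/bigcupP; exists i; rewrite ?Pc.
apply/bigcupsP=> i _; apply/subsetP=> y Py; rewrite -defK.
have <-: \prod_j (if j == i then y else 1) = y.
  by rewrite (big_only1 i) ?eqxx // => j /negPf->.
by apply: mem_prodg => j _; case: eqP => [->|].
Qed.

Theorem theorem5p3 (gT : finGroupType) (G : {group gT}) :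
  ON_group G <->
  (Dedekind_group G \/
   exists (n : nat) (ps : n.-tuple nat) (p : nat)
          (P_ : 'I_n -> {group gT}) (x : gT),
     let H1 : {set gT} := \prod_(i < n) (P_ i : {set gT}) in
     let P : {group gT} := <[x]>%G in
     [/\ (* ps and p enumerate the distinct prime divisors of #|G| *)
         perm_eq (rcons ps p) (primes #|G|),
         (* (1) *)
         [/\ H1 * P = G,
             (forall i : 'I_n,
                [/\ (tnth ps i).-Sylow(G) (P_ i), P_ i <| G & abelian (P_ i)]),
             p.-Sylow(G) P
           & <[x ^+ p]> = 'O_p(G)],
         (* (2) *)
         'N_G(P) = P
       & (* (3) *)
         forall w : gT, w \in H1 -> w != 1 ->
           exists m : int,
             [/\ w ^ x = expgz w m,
                 coprimez m #[w]%:Z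
               & coprimez (m - 1)%R #[w]%:Z]]).
Proof.
move=> /=; split=> [onG | [dedG H sHG | ]]; last 2 first.
- by right; apply: dedG.
- case=> n [ps [p [P_ [x [ps_perm [defG sylP_ sylP defO] NP powx]]]]].
  have ps_pr q : q \in rcons ps p -> prime q.
    by rewrite (perm_mem ps_perm) mem_primes => /andP[].
  have p_pr: prime p by rewrite ps_pr // mem_rcons inE eqxx.
  have uniq_ps: uniq (rcons ps p) by rewrite (perm_uniq ps_perm) primes_uniq.
  have [p'ps uniq_ps'] := andP (etrans (esym (rcons_uniq ps p)) uniq_ps).
  have nP i : P_ i <| G by case: (sylP_ i).
  have [K [defH defK nKG]] := prodg_normal nP.
  rewrite defH in defG powx.
  have sPO i : P_ i \subset 'O_p^'(G).
    have [/pHall_pgroup pP _ _] := sylP_ i; apply: pcore_max (nP i).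
    apply: sub_in_pnat pP => q _ /eqnP->; rewrite !inE.
    by apply: contraNneq p'ps => <-; apply: mem_tnth.
  have p'K: p^'.-group K.
    apply: pgroupS (pcore_pgroup _ G); rewrite defK gen_subG.
    by apply/bigcupsP=> i _.
  have abK: abelian K.
    rewrite defK abelian_gen; apply/bigcupsP=> i _; rewrite centsC.
    apply/bigcupsP=> j _; have [-> | neq_ij] := eqVneq i j.
      by case: (sylP_ j).
    (* Distinct primes give coprime orders, so [[~: P_ i, P_ j]] lies in a trivial intersection. *)
    have [[/pHall_pgroup pPi _ _] [/pHall_pgroup pPj _ _]] := (sylP_ i, sylP_ j).
    have coij: coprime #|P_ j| #|P_ i|.
      apply: pnat_coprime pPj _; apply: sub_in_pnat pPi => q _ /eqnP->.
      rewrite !inE; apply: contraNneq neq_ij => eq_ij; apply/eqP.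
      exact: (tuple_uniqP ps uniq_ps').
    rewrite (sameP commG1P trivgP) -(coprime_TIg coij) commg_subI //.
      by rewrite subsetI subxx (subset_trans (normal_sub (nP j))) ?normal_norm.
    by rewrite subsetI subxx (subset_trans (normal_sub (nP i))) ?normal_norm.
  apply: (power_action_ON p_pr sylP defO NP nKG abK defG p'K).
  move=> w Kw; have [-> | ntw] := eqVneq w 1.
    by exists 0; rewrite ?conj1g ?expg1n ?order1 ?coprimen1.
  have [m [-> com com1]] := powx w Kw ntw.
  exact: expgz_coprime_pred com com1.

(* Necessity of the conditions *)
have [/existsP[P /andP[sylP nnP]] | allN] :=
    boolP [exists P : {group gT}, Sylow G P && ~~ (P <| G)]; last first.
  left=> H sHG; have [-> | neqHG] := eqVneq (H : {set gT}) G.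
    exact: normal_refl.
  apply: (ON_nilpotent_sub onG (subxx G)); last first.
    by rewrite properEneq neqHG.
  apply: normal_Sylows_nilpotent => P sylP; apply: contraNT allN => nnP.
  by apply/existsP; exists P; rewrite sylP.
right; case/SylowP: sylP => p p_pr sylP.
have [x [defP ntx NP defO]] := ON_nonnormal_Sylow onG sylP nnP.
have [sPG pP _] := and3P sylP; have px: p.-elt x by rewrite /p_elt orderE -defP.
have Gx: x \in G by rewrite -cycle_subG -defP.
have pG: p \in primes #|G|.
  rewrite mem_primes p_pr cardG_gt0; apply: dvdn_trans (cardSg sPG).
  by have [] := pgroup_pdiv pP _; rewrite // defP cycle_eq1.
pose ps := in_tuple (rem p (primes #|G|)).
pose P_ i := 'O_(tnth ps i)(G)%G.
have ps_nP q : q \in ps -> q.-Sylow(G) 'O_q(G).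
  rewrite (mem_rem_uniq _ (primes_uniq _)) !inE mem_primes.
  case/andP=> neq_qp /and3P[q_pr _ _]; have [Q sylQ] := Sylow_exists q G.
  have [nQ | nnQ] := boolP (Q <| G); first by rewrite (normal_Hall_pcore sylQ nQ).
  have [y [defQ nty NQ _]] := ON_nonnormal_Sylow onG sylQ nnQ.
  case/eqP: neq_qp.
  apply: (self_normalizing_cyclic_prime_uniq G q_pr p_pr _ px nty ntx).
  - by rewrite /p_elt orderE -defQ; apply: pHall_pgroup sylQ.
  - by rewrite -defQ.
  by rewrite -defP.
have nP i : P_ i <| G by apply: pcore_normal.
have [K [defH defK nKG]] := prodg_normal nP.
have sP_K i : P_ i \subset K.
  by rewrite defK sub_gen //; apply: (bigcup_max i).
have nilK: nilpotent K.
  apply: nilpotentS (Fitting_nil G); rewrite defK gen_subG; apply/bigcupsP=> i _.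
  by rewrite Fitting_max // (pgroup_nil (pcore_pgroup _ _)).
have p'K: p^'.-group K.
  apply: pgroupS (pcore_pgroup _ G); rewrite defK gen_subG; apply/bigcupsP=> i _.
  apply: pcore_max (nP i); apply: sub_in_pnat (pcore_pgroup _ _) => q _ /eqnP->.
  by have := mem_tnth i ps; rewrite (mem_rem_uniq _ (primes_uniq _)) !inE => /andP[].
have fixx: 'C_K[x] = 1.
  (* What commutes with [x] normalises [P], so it lies in [P], which meets [K] trivially. *)
  have cxP: 'C_G[x] \subset P by rewrite -NP defP -cent_cycle setIS ?cent_sub.
  apply/trivgP; rewrite -(coprime_TIg (pnat_coprime pP p'K)) subsetI subsetIl andbT.
  exact: subset_trans (setSI _ (normal_sub nKG)) cxP.
have [powx abK] := ON_fixfree onG nKG nilK Gx fixx.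
exists _, ps, p, P_, x; rewrite defH; split.
- by rewrite perm_rcons perm_sym perm_to_rem.
- split=> //; last by rewrite -defP.
    have nKP: <[x]> \subset 'N(K) by rewrite -defP (subset_trans sPG) ?normal_norm.
    apply/eqP; rewrite -(norm_joinEr nKP) eqEcard join_subG (normal_sub nKG).
    (* The join contains a Sylow subgroup of [G] for every prime divisor of [#|G|]. *)
    rewrite cycle_subG Gx /= dvdn_leq ?cardG_gt0 //.
    apply/dvdn_partP=> // q; have [-> _ | neq_qp qG] := eqVneq q p.
      by rewrite -(card_Hall sylP) cardSg // defP joing_subr.
    have psq: q \in ps by rewrite (mem_rem_uniq _ (primes_uniq _)) !inE neq_qp.
    rewrite -(card_Hall (ps_nP q psq)) cardSg //.
    have /tnthP[i ->] := psq.
    exact: subset_trans (sP_K i) (joing_subl _ _).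
  move=> i; split; first exact: ps_nP (mem_tnth _ _).
    exact: nP.
  exact: abelianS (sP_K i) abK.
- by rewrite /= -defP.
move=> w Kw _; have [k wx cok] := powx w Kw.
exists (Posz k.+1); split=> //; last by rewrite -{1}addn1 PoszD GRing.addrK.
(* The conjugate [w ^ x = w ^+ k.+1] has the order of [w], so it generates [<[w]>] and [k.+1] is
   coprime to [#[w]]. *)
rewrite /coprimez /gcdz !absz_nat eqz_nat -[_ == _]/(coprime _ _).
rewrite coprime_sym -generator_coprime -wx /generator eq_sym eqEcard.
rewrite -!orderE orderJ leqnn andbT cycle_subG wx.
exact: mem_cycle.
Qed.
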